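(* Let $S$ be a numerical semigroup, and let $T=S\cup I$ be a numerical set associated to $S$, where $I$ is a self-dual order ideal of $(\mathrm{M}(S),\preccurlyeq)$. Then $|\lambda(S)|\le|\lambda(T)|$.
   Context: $\mathbb{N}=\{0,1,2,\dots\}$. A numerical set is a subset $T\subseteq\mathbb{N}$ with $0\in T$ and finite complement in $\mathbb{N}$. Its gaps are the elements of $\mathrm{G}(T)=\mathbb{N}\setminus T$; the largest gap is the Frobenius number $\mathrm{F}(T)$. A numerical semigroup is a numerical set closed under addition. The atom monoid of a numerical set $T$ is the numerical semigroup $\mathrm{A}(T)=\{x\in\mathbb{N}: x+T\subseteq T\}$; $T$ is a numerical set associated to $S$ if $\mathrm{A}(T)=S$. The enumeration $\lambda(T)$ of a numerical set $T$ is the integer partition whose Young diagram has as its profile (lower-right boundary) the lattice walk that, for $n=0,1,2,\dots,\mathrm{F}(T)$, takes a unit step right if $n\in T$ and a unit step up if $n\notin T$. Equivalently, the parts of $\lambda(T)$ are the numbers $\#\{u\in T: u<x\}$, one for each gap $x\in\mathrm{G}(T)$. The size $|\lambda|$ of a partition is the sum of its parts. The void of a numerical semigroup $S$ is $\mathrm{M}(S)=\{x\in\mathrm{G}(S):\mathrm{F}(S)-x\in\mathrm{G}(S)\}$, partially ordered by $x\preccurlyeq y$ if and only if $y-x\in S$. An order ideal of $(\mathrm{M}(S),\preccurlyeq)$ is a subset $I\subseteq\mathrm{M}(S)$ such that $x\in I$, $y\in\mathrm{M}(S)$ and $x\preccurlyeq y$ imply $y\in I$. An order ideal $I$ is self-dual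 if $x\in I$ implies $\mathrm{F}(S)-x\in I$. *)

(* Defs.v *)
From mathcomp Require Import all_boot.
From mathcomp Require Import finmap.
From mathcomp Require Import boolp classical_sets functions cardinality.

Set Implicit Arguments.
Unset Strict Implicit.
Unset Printing Implicit Defensive.

Local Open Scope classical_set_scope.

Definition gaps (T : set nat) : set nat := ~` T.

Definition numerical_set (T : set nat) : Prop := T 0 /\ finite_set (gaps T).

Definition numerical_semigroup (S : set nat) : Prop :=
  numerical_set S /\ (forall x y, S x -> S y -> S (x + y)).

(* The largest gap.  The value is 0 when there is no gap, i.e. when T = setT;
   [void_of] and [enumeration] are then empty, as 0 is not a gap. *)
Definition frobenius (T : set nat) : nat := \max_(x <- fset_set (gaps T)) x.

Definition atom_monoid (T : set nat) : set nat :=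
  [set x | [set x + t | t in T] `<=` T].

Definition associated (S T : set nat) : Prop :=
  numerical_set T /\ atom_monoid T = S.

(* The rows of the Young diagram.  The walk n = 0, ..., F(T) goes right when
   n \in T and up when n \notin T; the up step at a gap x closes, from the
   bottom row upwards, a row whose length is the number of right steps made so
   far, namely #{u \in T : u < x}.  Reversing lists the parts in nonincreasing
   order. *)
Definition enumeration (T : set nat) : seq nat :=
  rev [seq count (fun u => u \in T) (iota 0 x)
      | x <- iota 0 (frobenius T).+1 & x \notin T].

Definition partition_size (l : seq nat) : nat := sumn l.

(* The subtraction does not truncate, since a gap is at most F(S). *)
Definition void_of (S : set nat) : set nat :=
  [set x | gaps S x /\ gaps S (frobenius S - x)].

(* y - x is meant in the integers, so x <= y is required explicitly: the
   truncated difference 0 always belongs to S. *)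
Definition void_le (S : set nat) (x y : nat) : Prop := x <= y /\ S (y - x).

Definition order_ideal (S I : set nat) : Prop :=
  I `<=` void_of S /\
  (forall x y, I x -> void_of S y -> void_le S x y -> I y).

Definition self_dual (S I : set nat) : Prop :=
  forall x, I x -> I (frobenius S - x).

(* Main.v *)
Require Import Defs.
From mathcomp Require Import all_boot.
From mathcomp Require Import finmap.
From mathcomp Require Import boolp classical_sets cardinality.

Local Open Scope classical_set_scope.

(** The size of [enumeration T] is the number of pairs [u < x] with [u] in [T]
    and [x] a gap of [T].  Write [#(A, B)] for the number of pairs [u < x <= F]
    with [u] in [A] and [x] in [B], where [F] is the Frobenius number of [S],
    and let [G] be the set of gaps of [T].  If [I] is empty then [T = S].
    Otherwise [F] is a gap of [S], and it is not in the void as [0] is in [S];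
    hence [F] is also the Frobenius number of [T].  Since the gaps of [S] are
    those of [T] together with [I],

      |lambda(S)| = #(S, G) + #(S, I)  and  |lambda(T)| = #(S, G) + #(I, G),

    so that it suffices to show [#(S, I) <= #(I, G)].  The reflection
    [(u, x) |-> (F - x, F - u)] preserves [u < x]; it sends [x] in [I] to an
    element of [I] by self-duality, and [u] in [S] to a gap of [T]: [F - u] is
    not in [S] because [F] is not, and not in the void because its dual [u] is
    no gap.  Hence it injects the pairs counted by [#(S, I)] into those counted
    by [#(I, G)]. *)

Definition increasing_pairs (N : nat) (A B : set nat) : nat :=
  \sum_(x < N) \sum_(u < N) [&& u < x, (u : nat) \in A & (x : nat) \in B].

Lemma increasing_pairsUl N A1 A2 B : A1 `&` A2 = set0 ->
  increasing_pairs N (A1 `|` A2) B =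
  increasing_pairs N A1 B + increasing_pairs N A2 B.
Proof.
move=> dA; rewrite /increasing_pairs -big_split; apply: eq_bigr => x _ /=.
rewrite -big_split; apply: eq_bigr => u _ /=.
have : ((u : nat) \in A1) && ((u : nat) \in A2) = false.
  by rewrite -in_setI dA in_set0.
by rewrite in_setU; case: (u < x); case: (_ \in A1); case: (_ \in A2);
  case: (_ \in B).
Qed.

Lemma increasing_pairsUr N A B1 B2 : B1 `&` B2 = set0 ->
  increasing_pairs N A (B1 `|` B2) =
  increasing_pairs N A B1 + increasing_pairs N A B2.
Proof.
move=> dB; rewrite /increasing_pairs -big_split; apply: eq_bigr => x _ /=.
have dBx : ((x : nat) \in B1) && ((x : nat) \in B2) = false.
  by rewrite -in_setI dB in_set0.
rewrite -big_split; apply: eq_bigr => u _ /=; move: dBx.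
by rewrite in_setU; case: (u < x); case: (_ \in A); case: (_ \in B1);
  case: (_ \in B2).
Qed.

(** The pair [(u, x)] is sent to [(F - x, F - u)], which is injective on pairs
    bounded by [F] and keeps the smaller entry first. *)
Lemma increasing_pairs_reflect {F} {A B A' B' : set nat} :
    (forall u, u <= F -> A u -> B' (F - u)) ->
    (forall x, x <= F -> B x -> A' (F - x)) ->
  increasing_pairs F.+1 A B <= increasing_pairs F.+1 A' B'.
Proof.
move=> AB' BA'; rewrite {2}/increasing_pairs exchange_big /=.
rewrite (reindex_inj rev_ord_inj) /=; apply: leq_sum => x _.
rewrite [leqRHS](reindex_inj rev_ord_inj) /=; apply: leq_sum => u _.
have [] := boolP [&& _, _ & _] => // /and3P[ux /set_mem Au /set_mem Bx].
rewrite !subSS ltn_sub2l ?mem_set //=.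
- exact: AB' (leq_ord u) Au.
- exact: BA' (leq_ord x) Bx.
- exact: leq_trans ux (leq_ord x).
Qed.

Lemma bigmax_seq_mem (s : seq nat) : s != [::] -> \max_(x <- s) x \in s.
Proof.
elim: s => // a [|b s] IH _; first by rewrite big_seq1 mem_head.
rewrite big_cons in_cons /maxn; case: ifP => _; last by rewrite eqxx.
by rewrite IH // orbT.
Qed.

Lemma gap_le_frobenius {T : set nat} {x} :
  finite_set (gaps T) -> gaps T x -> x <= frobenius T.
Proof.
move=> fin gx; apply: (@leq_bigmax_seq _ _ xpredT id) => //.
by rewrite in_fset_set // mem_set.
Qed.

Lemma frobenius_gap {T : set nat} {x} :
  finite_set (gaps T) -> gaps T x -> gaps T (frobenius T).
Proof.
move=> fin gx; apply: set_mem; rewrite -in_fset_set //.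
apply: bigmax_seq_mem; apply/eqP => g0.
have : x \in fset_set (gaps T) by rewrite in_fset_set // mem_set.
by rewrite -[_ \in _]/(x \in enum_fset (fset_set (gaps T))) g0.
Qed.

Lemma partition_size_enumeration (T : set nat) :
  partition_size (enumeration T) =
  increasing_pairs (frobenius T).+1 T (gaps T).
Proof.
rewrite /partition_size /enumeration sumn_rev sumnE big_map big_filter.
rewrite -[iota _ _]/(index_iota 0 (frobenius T).+1) big_mkord big_mkcond.
apply: eq_bigr => x _ /=; rewrite in_setC.
case: (_ \notin T); last by rewrite big1 // => u _; rewrite !andbF.
rewrite -sum1_count -{1}[x : nat]subn0 big_mkord.
rewrite (big_ord_widen_cond (frobenius T).+1 (fun u => u \in T) (fun=> 1)).
  by rewrite big_mkcond; apply: eq_bigr => u _; rewrite andbT andbC; case: ifP.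
exact: ltnW.
Qed.

Theorem proposition2p11 (S I T : set nat)
    (hS : numerical_semigroup S)
    (hI : order_ideal S I)
    (hId : self_dual S I)
    (hTE : T = S `|` I)
    (hT : associated S T) :
  partition_size (enumeration S) <= partition_size (enumeration T).
Proof.
case: hS hI hT => -[S0 finS] addS [Ivoid _] [[_ finT] _].
(* When S has no gap, its Frobenius number is the default value 0, an element of
   S; a member of I rules this case out. *)
have [[x0 Ix0]|noI] := pselect (I !=set0); last first.
  have I0 : I = set0 by apply/eqP; apply: contra_notT noI => /set0P.
  by rewrite hTE I0 setU0.
have gS : gaps S (frobenius S).
  by have [gx0 _] := Ivoid _ Ix0; exact: frobenius_gap gx0.
have gT : gaps T (frobenius S).
  by rewrite hTE => -[//|/Ivoid[_]]; rewrite subnn.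
have FT : frobenius T = frobenius S.
  apply/eqP; rewrite eqn_leq gap_le_frobenius ?andbT //; last first.
    by have := frobenius_gap finT gT; rewrite {1}hTE => gTT ?; apply: gTT; left.
  exact: gap_le_frobenius.
have gapsS : gaps S = gaps T `|` I.
  rewrite hTE; apply/seteqP; split=> x; last first.
    by case=> [nSI Sx|/Ivoid[]//]; apply: nSI; left.
  move=> nSx; have [Ix|nIx] := pselect (I x); first by right.
  by left=> -[].
have disjSI : S `&` I = set0.
  by rewrite -subset0 => x [Sx /Ivoid[]].
have disjGI : gaps T `&` I = set0.
  by rewrite -subset0 hTE => x [nSI Ix]; apply: nSI; right.
rewrite !partition_size_enumeration FT {1}gapsS increasing_pairsUr //.
rewrite {2}hTE increasing_pairsUl // leq_add2l.
apply: increasing_pairs_reflect => [u uF Su|x _]; last exact: hId.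
rewrite hTE => -[SFu|/Ivoid[_]]; last by rewrite subKn.
(* If both u and F - u were in S, so would be their sum F. *)
by apply: gS; rewrite -(subnKC uF); exact: addS.
Qed.
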